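(* Let $X=(\ell_2^2\oplus\mathbb{R})_1$ be the three-dimensional Petty space, i.e. $\mathbb{R}^3$ with the norm $\|(x,y,z)\|=\sqrt{x^2+y^2}+|z|$. Let $H(X)$ and $H'(X)$ denote its Hadwiger number and its strict Hadwiger number. Then $$14\le H'(X)\le H(X)\le 16.$$
   Context: For a finite-dimensional normed space $X$ with unit ball $B$ and unit sphere $S_X$: the Hadwiger number $H(X)$ is the maximum number of balls of radius $1$ that touch $B$ and have pairwise disjoint interiors (the balls kiss $B$, i.e. each meets $B$ and has interior disjoint from the interior of $B$). The strict Hadwiger number $H'(X)$ is the maximum number of pairwise disjoint balls of radius $1$ touching $B$. Equivalently, $H(X)$ is the maximum cardinality of a subset $S\subseteq S_X$ with $\|x-y\|\ge 1$ for all distinct $x,y\in S$ (a $1$-separated set), and $H'(X)$ is the maximum cardinality of a subset $S\subseteq S_X$ with $\|x-y\|>1$ for all distinct $x,y\in S$ (a $1^+$-separated set). *)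

(* Defs.v *)
From HB Require Import structures.
From mathcomp Require Import all_boot all_order all_algebra.
From mathcomp Require Import all_classical all_reals all_analysis.
From mathcomp Require Import ring.

Set Implicit Arguments.
Unset Strict Implicit.
Unset Printing Implicit Defensive.

Import Order.TTheory GRing.Theory Num.Theory.
Import numFieldNormedType.Exports.

Local Open Scope classical_set_scope.
Local Open Scope ring_scope.

Section Hadwiger.
Context {R : realType} (X : normedModType R).

Definition touches (A B : set X) : Prop :=
  A `&` B !=set0 /\ A° `&` B° = set0.

(* The balls are given by their centres. In both families below the centres are
   automatically pairwise distinct, since unit balls have nonempty interior, so
   n is the number of balls. *)
Definition kissing_family (n : nat) (c : 'I_n -> X) : Prop :=
  (forall i, touches (closed_ball (c i) 1) (closed_ball 0 1)) /\
  trivIset setT (fun i => (closed_ball (c i) 1)°).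

Definition strict_kissing_family (n : nat) (c : 'I_n -> X) : Prop :=
  (forall i, touches (closed_ball (c i) 1) (closed_ball 0 1)) /\
  trivIset setT (fun i => closed_ball (c i) 1).

Definition is_maximum (A : set nat) (m : nat) : Prop := A m /\ ubound A m.

Definition is_hadwiger_number (h : nat) : Prop :=
  is_maximum [set n | exists c : 'I_n -> X, kissing_family c] h.

Definition is_strict_hadwiger_number (h : nat) : Prop :=
  is_maximum [set n | exists c : 'I_n -> X, strict_kissing_family c] h.

End Hadwiger.

(* R^3 as an alias carrying only the linear structure of the product, so that
   the sup norm and the topology of the product are not inherited. *)
Definition petty_space (R : realType) : Type := (R^o * R^o * R^o)%type.

HB.instance Definition _ (R : realType) :=
  GRing.Lmodule.copy (petty_space R) (R^o * R^o * R^o)%type.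

Section PettyNorm.
Context {R : realType}.
Implicit Types p q : petty_space R.

Definition petty_norm p : R :=
  Num.sqrt (p.1.1 ^+ 2 + p.1.2 ^+ 2) + `|p.2|.

Let sqrt_sumD (a b c d : R) :
  Num.sqrt ((a + c) ^+ 2 + (b + d) ^+ 2) <=
  Num.sqrt (a ^+ 2 + b ^+ 2) + Num.sqrt (c ^+ 2 + d ^+ 2).
Proof.
have ss (x y : R) : 0 <= x ^+ 2 + y ^+ 2 by rewrite addr_ge0 ?sqr_ge0.
set u := Num.sqrt (a ^+ 2 + _); set v := Num.sqrt (c ^+ 2 + _).
have u0 : 0 <= u by exact: sqrtr_ge0.
have v0 : 0 <= v by exact: sqrtr_ge0.
have uE : u ^+ 2 = a ^+ 2 + b ^+ 2 by rewrite sqr_sqrtr.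
have vE : v ^+ 2 = c ^+ 2 + d ^+ 2 by rewrite sqr_sqrtr.
have CS : a * c + b * d <= u * v.
  apply: le_trans (ler_norm _) _.
  rewrite -(@ler_pXn2r _ 2) ?nnegrE ?mulr_ge0 ?normr_ge0//.
  rewrite real_normK ?num_real// exprMn uE vE -subr_ge0.
  suff -> : (a ^+ 2 + b ^+ 2) * (c ^+ 2 + d ^+ 2) - (a * c + b * d) ^+ 2 =
    (a * d - b * c) ^+ 2 by exact: sqr_ge0.
  by ring.
rewrite -(@ler_pXn2r _ 2) ?nnegrE ?addr_ge0 ?sqrtr_ge0//.
rewrite sqr_sqrtr// [leRHS]sqrrD uE vE.
suff -> : (a + c) ^+ 2 + (b + d) ^+ 2 =
  a ^+ 2 + b ^+ 2 + (a * c + b * d) *+ 2 + (c ^+ 2 + d ^+ 2).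
  by rewrite lerD2r lerD2l lerMn2r/= CS.
by ring.
Qed.

Let petty_normD p q : petty_norm (p + q) <= petty_norm p + petty_norm q.
Proof.
case: p q => [[a b] c] [[a' b'] c']; rewrite /petty_norm/= addrACA.
apply: lerD; last exact: ler_normD.
exact: sqrt_sumD.
Qed.

Let petty_normZ (l : R) p : petty_norm (l *: p) = `|l| * petty_norm p.
Proof.
case: p => [[x y] z].
rewrite /petty_norm [in LHS]/= [(_ + _ : R)%R in RHS]/=.
rewrite -[(l *: x : R^o)]/(l * x) -[(l *: y : R^o)]/(l * y).
rewrite -[(l *: z : R^o)]/(l * z) normrM !exprMn.
by rewrite -mulrDr sqrtrM ?sqr_ge0// sqrtr_sqr -mulrDr.
Qed.

Let petty_norm0_eq0 p : petty_norm p = 0 -> p = 0.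
Proof.
case: p => -[x y] z; rewrite /petty_norm /= => /eqP.
rewrite paddr_eq0 ?sqrtr_ge0// sqrtr_eq0 normr_eq0.
move=> /andP[+ /eqP ->] => xy.
have: x ^+ 2 + y ^+ 2 == 0 by rewrite eq_le xy addr_ge0 ?sqr_ge0.
by rewrite paddr_eq0 ?sqr_ge0// !sqrf_eq0 => /andP[/eqP -> /eqP ->].
Qed.

HB.instance Definition _ := Lmodule_isNormed.Build R (petty_space R)
  petty_normD petty_normZ petty_norm0_eq0.

Lemma petty_normE p : `|p| = Num.sqrt (p.1.1 ^+ 2 + p.1.2 ^+ 2) + `|p.2|.
Proof. by []. Qed.

End PettyNorm.

(* Main.v *)
(* Let r be the distance of a unit vector to the vertical axis and t its angle
   around that axis. In each closed half-space at most one of the points has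
   r < 1/2. For the others put a := 1 - 1/(2r), so that 0 <= a <= 1/2; then
   1-separation gives 1 - cos (t - t') >= 2aa' for any two points, and
   1 - cos (t - t') >= 2(1 - 2a + aa') for two points on the same side of the
   equator with a' <= a. Two step functions of a serve as half-widths of arcs of
   the circle: arcs of half-width equator_width are disjoint for all points
   together, arcs of half-width cap_width are disjoint among the points of each
   side. Each family has total half-width at most pi, and every point satisfies
   1 <= 13/5 equator_width + 27/25 cap_width, so the number of points with
   r >= 1/2 is at most (13/5 + 2 * 27/25) pi < 15, whence H <= 14 + 2.
   For the lower bound, the poles and the orbits of (1, 0, 0),
   (119, -120, -72)/241 and (404, 303, -495)/1000 under
   (x, y, z) |-> (-y, x, -z) are 14 points at distances greater than 1. *)

Require Import Defs.
From HB Require Import structures.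
From mathcomp Require Import all_boot all_order all_algebra.
From mathcomp Require Import all_classical all_reals all_analysis.
From mathcomp Require Import ring lra.

Set Implicit Arguments.
Unset Strict Implicit.
Unset Printing Implicit Defensive.

Import Order.TTheory GRing.Theory Num.Theory.
Import numFieldNormedType.Exports.

Local Open Scope classical_set_scope.
Local Open Scope ring_scope.

(** * Touching unit balls expressed through distances of centres *)

Section KissingFamilies.
Context {R : realType} (X : normedModType R).
Implicit Types x y : X.

Let midpoint_dist x y : `|x - 2^-1 *: (x + y)| = 2^-1 * `|x - y|.
Proof.
have -> : x - 2^-1 *: (x + y) = 2^-1 *: (x - y).
  apply: (@scalerI _ _ 2) => //; rewrite scalerBr !scalerA divff// !scale1r.
  by rewrite scaler_nat mulr2n opprD addrA addrK.
by rewrite normrZ gtr0_norm ?invr_gt0.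
Qed.

Let midpoint_distC x y : `|y - 2^-1 *: (x + y)| = 2^-1 * `|x - y|.
Proof. by rewrite [x + y]addrC midpoint_dist distrC. Qed.

(** The triangle inequality gives one direction; the midpoint of the centres is a common point for
    the other. *)
Lemma closed_balls_meet x y :
  closed_ball x 1 `&` closed_ball y 1 !=set0 <-> `|x - y| <= 2.
Proof.
rewrite !closed_ballE// /closed_ball_; split=> [[z [/= xz yz]]|xy].
  by rewrite (le_trans (ler_distD z _ _))// [`|z - _|]distrC; lra.
exists (2^-1 *: (x + y)); split => /=.
  by rewrite midpoint_dist; lra.
by rewrite midpoint_distC; lra.
Qed.

Lemma open_balls_meet x y :
  (closed_ball x 1)° `&` (closed_ball y 1)° !=set0 <-> `|x - y| < 2.
Proof.
rewrite !interior_closed_ballE// -!ball_normE; split=> [[z [/= xz yz]]|xy].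
  by rewrite (le_lt_trans (ler_distD z _ _))// [`|z - _|]distrC; lra.
exists (2^-1 *: (x + y)); split => /=.
  by rewrite midpoint_dist; lra.
by rewrite midpoint_distC; lra.
Qed.

Lemma touches_unit_ball x :
  touches (closed_ball x 1) (closed_ball 0 1) <-> `|x| = 2.
Proof.
have -> : `|x| = 2 <-> `|x - 0| <= 2 /\ ~ `|x - 0| < 2.
  rewrite subr0; split=> [->|[x2 /negP]]; first by rewrite ltxx lexx.
  by rewrite -leNgt => ?; apply/eqP; rewrite eq_le x2.
rewrite -closed_balls_meet -open_balls_meet /touches.
by rewrite -nonemptyPn.
Qed.

(** Passage from balls to vectors: halving the centres turns a kissing family into a 1-separated
    family of unit vectors. *)
Lemma kissing_familyP n (c : 'I_n -> X) : kissing_family c <->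
  (forall i, `|c i| = 2) /\ (forall i j, i != j -> 2 <= `|c i - c j|).
Proof.
split=> [[ct cd]|[c2 csep]]; split.
- by move=> i; apply/touches_unit_ball.
- move=> i j; rewrite leNgt; apply: contraNN => /open_balls_meet ij.
  by apply/eqP; apply: cd.
- by move=> i; apply/touches_unit_ball.
- move=> i j _ _ /open_balls_meet; apply: contraPP => /eqP/csep.
  by rewrite leNgt => /negP.
Qed.

Lemma strict_kissing_familyP n (c : 'I_n -> X) : strict_kissing_family c <->
  (forall i, `|c i| = 2) /\ (forall i j, i != j -> 2 < `|c i - c j|).
Proof.
split=> [[ct cd]|[c2 csep]]; split.
- by move=> i; apply/touches_unit_ball.
- move=> i j; rewrite ltNge; apply: contraNN => /closed_balls_meet ij.
  by apply/eqP; apply: cd.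
- by move=> i; apply/touches_unit_ball.
- move=> i j _ _ /closed_balls_meet; apply: contraPP => /eqP/csep.
  by rewrite ltNge => /negP.
Qed.

Lemma strict_kissing_family_kissing n (c : 'I_n -> X) :
  strict_kissing_family c -> kissing_family c.
Proof.
move=> /strict_kissing_familyP[c2 csep]; apply/kissing_familyP.
by split=> // i j /csep/ltW.
Qed.

End KissingFamilies.

Lemma exists_maximum (A : set nat) (m b : nat) : A m -> ubound A b ->
  exists2 h, is_maximum A h & (m <= h <= b)%N.
Proof.
move=> Am Ab.
have exA : exists n, `[< A n >] by exists m; exact/asboolP.
have leA n : `[< A n >] -> (n <= b)%N by move=> /asboolP/Ab.
case: (ex_maxnP exA leA) => h /asboolP Ah hmax.
exists h; first by split=> // n An; apply: hmax; apply/asboolP.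
by rewrite leA ?andbT; [apply: hmax|]; apply/asboolP.
Qed.

(** * Taylor bounds for sine and cosine, and a bound for pi *)

Section Trigonometry.
Context {R : realType}.
Implicit Types x y : R.

(** By the mean value theorem. Each use below raises the degree of a Taylor bound by one, since the
    derivative of each remainder is the preceding remainder. *)
Lemma ge0_is_derive (f g : R -> R) :
  (forall t : R, is_derive t (1 : R) f (g t)) -> f 0 = 0 ->
  (forall t : R, 0 <= t -> 0 <= g t) -> forall x, 0 <= x -> 0 <= f x.
Proof.
move=> fg f0 g0 x x0; rewrite -f0.
have [c /andP[c0 _] ] : exists2 c, c \in `[0, x] & f x - f 0 = g c * (x - 0).
  apply: MVT_segment => //.
  apply: continuous_subspaceT => y; apply: differentiable_continuous.
  by apply/derivable1_diffP; have [] := fg y.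
by move=> E; rewrite -subr_ge0 E mulr_ge0 ?subr0// g0.
Qed.

Lemma sin_le_id x : 0 <= x -> sin x <= x.
Proof.
move=> x0; rewrite -subr_ge0; move: x x0.
apply: (@ge0_is_derive (fun t : R => t - sin t)
  (fun t : R => 1 - cos t)) => [|t _].
- by rewrite sin0 subr0.
- by rewrite subr_ge0 cos_le1.
Qed.

Lemma cos_ge_deg2 x : 0 <= x -> 1 - x ^+ 2 / 2 <= cos x.
Proof.
move=> x0; rewrite -subr_ge0; move: x x0.
apply: (@ge0_is_derive (fun t : R => cos t - (1 - t ^+ 2 / 2))
  (fun t : R => t - sin t)) => [t||t t0].
- apply: is_derive_eq; rewrite /GRing.scale/=; by field.
- by rewrite cos0; field.
- by have := sin_le_id t0; lra.
Qed.

Lemma sin_ge_deg3 x : 0 <= x -> x - x ^+ 3 / 6 <= sin x.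
Proof.
move=> x0; rewrite -subr_ge0; move: x x0.
apply: (@ge0_is_derive (fun t : R => sin t - (t - t ^+ 3 / 6))
  (fun t : R => cos t - (1 - t ^+ 2 / 2))) => [t||t t0].
- apply: is_derive_eq; rewrite /GRing.scale/=; by field.
- by rewrite sin0; field.
- by have := cos_ge_deg2 t0; lra.
Qed.

Lemma cos_le_deg4 x : 0 <= x -> cos x <= 1 - x ^+ 2 / 2 + x ^+ 4 / 24.
Proof.
move=> x0; rewrite -subr_ge0; move: x x0.
apply: (@ge0_is_derive (fun t : R => 1 - t ^+ 2 / 2 + t ^+ 4 / 24 - cos t)
  (fun t : R => sin t - (t - t ^+ 3 / 6))) => [t||t t0].
- apply: is_derive_eq; rewrite /GRing.scale/=; by field.
- by rewrite cos0; field.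
- by have := sin_ge_deg3 t0; lra.
Qed.

Lemma sin_le_deg5 x : 0 <= x -> sin x <= x - x ^+ 3 / 6 + x ^+ 5 / 120.
Proof.
move=> x0; rewrite -subr_ge0; move: x x0.
apply: (@ge0_is_derive (fun t : R => t - t ^+ 3 / 6 + t ^+ 5 / 120 - sin t)
  (fun t : R => 1 - t ^+ 2 / 2 + t ^+ 4 / 24 - cos t)) => [t||t t0].
- apply: is_derive_eq; rewrite /GRing.scale/=; by field.
- by rewrite sin0; field.
- by have := cos_le_deg4 t0; lra.
Qed.

(* The coefficient is generalised so that the search for a derivative does not
   unfold the numeral 720. *)
Lemma cos_ge_deg6 x : 0 <= x ->
  1 - x ^+ 2 / 2 + x ^+ 4 / 24 - x ^+ 6 / 720 <= cos x.
Proof.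
have [c cE] : exists c : R, c = 720^-1 by exists 720^-1.
rewrite -cE => x0; rewrite -subr_ge0; move: x x0.
apply: (@ge0_is_derive
  (fun t : R => cos t - (1 - t ^+ 2 / 2 + t ^+ 4 / 24 - t ^+ 6 * c))
  (fun t : R => t - t ^+ 3 / 6 + t ^+ 5 / 120 - sin t)) => [t||t t0].
- apply: is_derive_eq; rewrite /GRing.scale/= cE; by field.
- by rewrite cos0; field.
- by have := sin_le_deg5 t0; lra.
Qed.

(* The duplication formula keeps the degree of the Taylor bound at 4. *)
Lemma pi_lt_315 : pi < 63 / 20 :> R.
Proof.
have c_le : cos (63 / 80) <= 1 - (63 / 80) ^+ 2 / 2 + (63 / 80) ^+ 4 / 24 :> R.
  by apply: cos_le_deg4; lra.
have c_ge : 1 - (63 / 80) ^+ 2 / 2 <= cos (63 / 80) :> R.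
  by apply: cos_ge_deg2; lra.
have c2 : cos (63 / 40) < 0 :> R.
  have -> : 63 / 40 = (63 / 80) *+ 2 :> R by lra.
  rewrite cos_mulr2n; move: c_le c_ge; set c := cos _ => c_le c_ge.
  (* 41/58 lies just below 1/sqrt 2, as 2 * 41^2 = 3362 < 58^2 = 3364, and still above the Taylor
     bound for [c]; hence 2c^2 < 1. *)
  have : 0 <= (41 / 58 - c) * (41 / 58 + c) by apply: mulr_ge0; lra.
  lra.
rewrite ltNge; apply/negP => pi_ge.
have : 0 <= cos (63 / 40) :> R by apply: cos_ge0_pihalf; apply/andP; split; lra.
by rewrite leNgt c2.
Qed.

End Trigonometry.

(** * Packing intervals in a segment and arcs in a circle *)

Section ArcPacking.
Context {R : realType}.

(** Induction on the number of intervals: without the rightmost one, centred at [t m], the rest fit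
    in the segment from [a] to [t m - h m]. *)
Lemma segment_packing (I : finType) (t h : I -> R) (S : {set I}) (a b : R) :
  a <= b ->
  {in S, forall i, a + h i <= t i <= b - h i} ->
  {in S, forall i, 0 <= h i} ->
  {in S &, forall i j, i != j -> h i + h j <= `|t i - t j|} ->
  2 * (\sum_(i in S) h i) <= b - a.
Proof.
have [n] := ubnP #|S|; elim: n => // n IH in S b *.
rewrite ltnS => Sn ab St h0 Sh.
have [->|[k kS]] := set_0Vmem S; first by rewrite big_set0 mulr0 subr_ge0.
have [m mS tm] : exists2 m, m \in S & {in S, forall i, t i <= t m}.
  by exists [arg max_(i > k in S) t i]%O; case: arg_maxP.
have [am mb] := andP (St m mS); have hm := h0 m mS.
rewrite (big_setD1 m)//=.
suff : 2 * (\sum_(i in S :\ m) h i) <= (t m - h m) - a by lra.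
apply: IH => [|||i /setD1P[_ /h0]//|i j /setD1P[_ iS] /setD1P[_ jS]].
- by rewrite (leq_trans _ Sn)// [leqRHS](cardsD1 m S) mS.
- lra.
- move=> i /setD1P[im iS]; have /andP[-> _] := St i iS.
  have := Sh i m iS mS im; rewrite ler0_norm ?subr_le0 ?tm//; lra.
- exact: Sh.
Qed.

Lemma cos_le_arc (d w : R) : 0 <= w -> - (pi *+ 2) <= d <= pi *+ 2 ->
  w <= pi -> cos d <= cos w -> w <= `|d| <= pi *+ 2 - w.
Proof.
move=> w0 dpi wpi; rewrite -cos_norm; move: dpi; rewrite -ler_norml.
have := normr_ge0 d; move: `|d| => e e0 e2 ce; have p0 := pi_ge0 R.
have cosW x : 0 <= x <= pi -> cos x <= cos w -> w <= x.
  move=> xpi; rewrite [cos x <= _]leNgt [w <= x]leNgt; apply: contraNN => xw.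
  by rewrite ltr_cos// in_itv//= w0.
have [epi|epi] := leP e pi.
  have we : w <= e by apply: cosW; rewrite ?e0.
  by rewrite we/=; lra.
(* Beyond pi, reflecting [e] to 2 pi - [e] keeps the cosine and returns to the range where it
   decreases. *)
suff : w <= pi *+ 2 - e by lra.
apply: cosW; first lra.
by rewrite -cosN opprB -(cosD2pi (e - _)) subrK.
Qed.

(* Arcs of the circle centred at the angles t i with half-widths h i. *)
Lemma arc_packing (I : finType) (t h : I -> R) (S : {set I}) :
  {in S, forall i, 0 <= t i < pi *+ 2} ->
  {in S, forall i, 0 <= h i <= pi} ->
  {in S &, forall i j, i != j ->
    h i + h j <= pi /\ cos (t i - t j) <= cos (h i + h j)} ->
  \sum_(i in S) h i <= pi.
Proof.
move=> St Sh Sc.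
have [->|[k kS]] := set_0Vmem S; first by rewrite big_set0 pi_ge0.
have [m mS tm] : exists2 m, m \in S & {in S, forall i, t m <= t i}.
  by exists [arg min_(i < k in S) t i]%O; case: arg_minP.
have arcs : {in S &, forall i j, i != j ->
    h i + h j <= `|t i - t j| <= pi *+ 2 - (h i + h j)}.
  move=> i j iS jS ij; have [hpi ct] := Sc i j iS jS ij.
  have [/andP[] + + /andP[] + +] := (St i iS, St j jS).
  have [/andP[] + _ /andP[] + _] := (Sh i iS, Sh j jS).
  by move=> *; apply: cos_le_arc => //; [exact: addr_ge0|lra].
have /andP[hm0 hmpi] := Sh m mS.
(* Cut the circle at the left end of the arc with the least angle. The upper bounds in [arcs] keep
   the other arcs from crossing the cut, so all lie in a segment of length 2 pi. *)
suff : 2 * (\sum_(i in S) h i) <= t m - h m + pi *+ 2 - (t m - h m) by lra.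
apply: (segment_packing (t := t)) => [|i iS|i iS|i j iS jS ij].
- by have := pi_ge0 R; lra.
- have [->|im] := eqVneq i m; first by apply/andP; split; lra.
  have := arcs i m iS mS im; rewrite ger0_norm ?subr_ge0 ?tm// => /andP[? ?].
  by apply/andP; split; lra.
- by have /andP[] := Sh i iS.
- by have /andP[] := arcs i j iS jS ij.
Qed.

End ArcPacking.

(** * The two step functions and their numerical inequalities *)

Section Widths.
Context {R : realType}.
Implicit Types a b c d v w : R.

(* Rounded solution of a linear program: for six steps, minimise the total
   weight of the three families of arcs subject to the inequalities
   width_cover, equator_width_pair and cap_width_pair; any total below 15 / pi
   would do. *)
Definition equator_width a : R :=
  if a < 4 / 25 then 0 else if a < 47 / 200 then 1 / 10 else
  if a < 3 / 10 then 21 / 100 else if a < 7 / 20 then 59 / 200 else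
  if a < 19 / 50 then 7 / 20 else 77 / 200.

Definition cap_width a : R :=
  if a < 4 / 25 then 93 / 100 else if a < 47 / 200 then 69 / 100 else
  if a < 3 / 10 then 17 / 40 else if a < 7 / 20 then 11 / 50 else
  if a < 19 / 50 then 17 / 200 else 0.

Lemma equator_width_itv a : 0 <= equator_width a <= 1.
Proof.
by rewrite /equator_width; do 5 ?[case: (ltP a) => _]; apply/andP; split; lra.
Qed.

Lemma cap_width_itv a : 0 <= cap_width a <= 1.
Proof.
by rewrite /cap_width; do 5 ?[case: (ltP a) => _]; apply/andP; split; lra.
Qed.

Lemma width_cover a : 1 <= 13 / 5 * equator_width a + 27 / 25 * cap_width a.
Proof.
by rewrite /equator_width /cap_width; do 5 ?[case: (ltP a) => _]; lra.
Qed.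

(** Upper bound for 1 - cos on nonnegative arguments, by [cos_ge_deg6]; it reduces the width
    inequalities to rational arithmetic. *)
Let versin_bound x : R := x ^+ 2 / 2 - x ^+ 4 / 24 + x ^+ 6 / 720.

(** The product increases in both arguments, so each pair of steps is checked at its two left
    endpoints [c] and [d]. Positive widths exclude the lowest step. *)
Lemma equator_width_pair a b :
  0 < equator_width a -> 0 < equator_width b ->
  1 - cos (equator_width a + equator_width b) <= 2 * (a * b).
Proof.
have key c d v w : 0 <= c -> 0 <= d -> 0 <= v -> 0 <= w ->
    versin_bound (v + w) <= 2 * (c * d) -> c <= a -> d <= b ->
    1 - cos (v + w) <= 2 * (a * b).
  move=> c0 d0 v0 w0 le_cd ca db.
  have := cos_ge_deg6 (addr_ge0 v0 w0); have := ler_pM c0 d0 ca db.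
  move: le_cd; rewrite /versin_bound; lra.
rewrite /equator_width.
case: (ltP a) => [_|a1]; first by rewrite ltxx.
case: (ltP b) => [_|b1]; first by rewrite ltxx.
do 4 ?[case: (ltP a) => [_|?]]; do 4 ?[case: (ltP b) => [_|?]] => _ _;
  match goal with H : is_true (?c <= a), K : is_true (?d <= b) |- _ =>
    apply: (key c d _ _ _ _ _ _ _ H K); rewrite /versin_bound; clear; lra end.
Qed.

(** The right side is 2(1 - a(2 - b)), which decreases in [a] and increases in [b]: the worst case
    is the right end [c] of the step of [a] and the left end [d] of the step of [b]. *)
Lemma cap_width_pair a b : 0 <= b <= a -> a <= 1 / 2 ->
  0 < cap_width a -> 0 < cap_width b ->
  1 - cos (cap_width a + cap_width b) <= 2 * (1 - 2 * a + a * b).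
Proof.
move=> /andP[b0 ba] a2.
have key c d v w : 0 <= c -> 0 <= v -> 0 <= w ->
    versin_bound (v + w) <= 2 * (1 - c * (2 - d)) -> a < c -> d <= b ->
    1 - cos (v + w) <= 2 * (1 - 2 * a + a * b).
  move=> c0 v0 w0 le_cd /ltW ac db.
  have := cos_ge_deg6 (addr_ge0 v0 w0).
  have : a * (2 - b) <= c * (2 - d) by apply: ler_pM; lra.
  move: le_cd; rewrite /versin_bound; lra.
rewrite /cap_width.
do 5 ?[case: (ltP a) => ?]; do 5 ?[case: (ltP b) => ?] => a_gt0 b_gt0;
  match goal with
  | _ => exfalso; lra
  | H : is_true (a < ?c), K : is_true (?d <= b) |- _ =>
    apply: (key c d _ _ _ _ _ _ H K); rewrite /versin_bound; clear; lra
  end.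
Qed.

End Widths.

(** * Upper bound for separated unit vectors *)

Section PettySpace.
Context {R : realType}.

(* Points of width 0 impose nothing and are dropped before packing arcs. *)
Lemma width_packing (I : finType) (t w : I -> R) (S : {set I}) :
  {in S, forall i, 0 <= t i < pi *+ 2} ->
  {in S, forall i, 0 <= w i <= 1} ->
  {in S &, forall i j, i != j -> 0 < w i -> 0 < w j ->
    1 - cos (w i + w j) <= 1 - cos (t i - t j)} ->
  \sum_(i in S) w i <= pi.
Proof.
move=> St Sw Sc; have p2 := pi_ge2 R.
rewrite (bigID (fun i => 0 < w i))/= [X in _ + X]big1 ?addr0; last first.
  move=> i /andP[/Sw/andP[w0 _]]; rewrite -leNgt => wn.
  by apply/eqP; rewrite eq_le wn.
rewrite (eq_bigl (mem (S :&: [set i | 0 < w i]%SET))); last first.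
  by move=> i; rewrite !inE.
apply: (arc_packing (t := t)).
- by move=> i /setIP[/St].
- by move=> i /setIP[/Sw/andP[-> /le_trans->//]]; lra.
- move=> i j /setIP[iS + ] /setIP[jS +] ij; rewrite !inE => wi wj.
  have /andP[_ wi1] := Sw i iS; have /andP[_ wj1] := Sw j jS.
  by have := Sc i j iS jS ij wi wj; split; lra.
Qed.

Lemma band_card (I : finType) (S : {set I}) (a t : I -> R) (s : pred I) :
  {in S, forall i, 0 <= a i <= 1 / 2} ->
  {in S, forall i, 0 <= t i < pi *+ 2} ->
  {in S &, forall i j, i != j -> 2 * (a i * a j) <= 1 - cos (t i - t j)} ->
  {in S &, forall i j, i != j -> s i = s j -> a j <= a i ->
    2 * (1 - 2 * a i + a i * a j) <= 1 - cos (t i - t j)} ->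
  (#|S| <= 14)%N.
Proof.
move=> Sa St Sopp Ssame.
have equator : \sum_(i in S) equator_width (a i) <= pi.
  apply: (width_packing (t := t)) => // [i _|i j iS jS ij wi wj].
    exact: equator_width_itv.
  exact: le_trans (equator_width_pair wi wj) (Sopp _ _ iS jS ij).
have cap (b : bool) : \sum_(i in S | s i == b) cap_width (a i) <= pi.
  rewrite (eq_bigl (mem (S :&: [set i | s i == b]%SET))); last first.
    by move=> i; rewrite !inE.
  apply: (width_packing (t := t)) => [i /setIP[/St]//|i _|].
    exact: cap_width_itv.
  move=> i j /setIP[iS +] /setIP[jS +] ij; rewrite !inE => /eqP si /eqP sj.
  have /andP[ai0 ai1] := Sa i iS; have /andP[aj0 aj1] := Sa j jS.
  have [aji|/ltW aij] := leP (a j) (a i) => wi wj.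
    apply: le_trans (cap_width_pair _ ai1 wi wj) _; first by rewrite aj0.
    by apply: Ssame; rewrite ?si.
  (* The bound for one side expects the larger value of [a] first, so the two points exchange
     roles. *)
  rewrite [cap_width _ + _]addrC -[t i - t j]opprB cosN.
  apply: le_trans (cap_width_pair _ aj1 wj wi) _; first by rewrite ai0.
  by apply: Ssame; rewrite ?si// eq_sym.
have cover : #|S|%:R <= 13 / 5 * (\sum_(i in S) equator_width (a i)) +
    27 / 25 * (\sum_(i in S) cap_width (a i)) :> R.
  rewrite -sumr_const !mulr_sumr -big_split/=.
  by apply: ler_sum => i _; exact: width_cover.
rewrite -ltnS -(ltr_nat R).
have capT : \sum_(i in S | s i) cap_width (a i) <= pi.
  by have := cap true; under eq_bigl do rewrite eqb_id.
have capF : \sum_(i in S | ~~ s i) cap_width (a i) <= pi.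
  by have := cap false; under eq_bigl do rewrite eqbF_neg.
move: cover; rewrite [X in 27 / 25 * X](bigID s)/=.
(* (13/5 + 2 * 27/25) * 63/20 = 14.994, just below 15. *)
have := @pi_lt_315 R; lra.
Qed.

Lemma polar_coordinates (x y : R) : exists2 t : R, 0 <= t < pi *+ 2 &
  x = Num.sqrt (x ^+ 2 + y ^+ 2) * cos t /\
  y = Num.sqrt (x ^+ 2 + y ^+ 2) * sin t.
Proof.
have p0 := pi_gt0 R; set r := Num.sqrt _.
have rE : r ^+ 2 = x ^+ 2 + y ^+ 2 by rewrite sqr_sqrtr// addr_ge0 ?sqr_ge0.
have r_ge0 : 0 <= r by exact: sqrtr_ge0.
clearbody r; have [r0|rn0] := eqVneq r 0.
  exists 0; first by rewrite lexx/=; lra.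
  move/esym/eqP: rE; rewrite r0 expr0n/= paddr_eq0 ?sqr_ge0// !sqrf_eq0.
  by move=> /andP[/eqP -> /eqP ->]; rewrite !mul0r.
have r_gt0 : 0 < r by rewrite lt_def rn0.
have xr : -1 <= x / r <= 1.
  rewrite -ler_norml normrM normfV (gtr0_norm r_gt0) ler_pdivrMr// mul1r.
  rewrite -(@ler_pXn2r _ 2) ?nnegrE ?normr_ge0 ?(ltW r_gt0)//.
  rewrite real_normK ?num_real//.
  by rewrite rE lerDl sqr_ge0.
have cosE : x = r * cos (acos (x / r)) by rewrite acosK// mulrC divfK.
have sinE : `|y| = r * sin (acos (x / r)).
  rewrite sin_acos// -[in LHS]sqrtr_sqr -[X in _ = X * _]gtr0_norm// -sqrtr_sqr.
  rewrite -sqrtrM ?sqr_ge0//; congr Num.sqrt.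
  have -> : y ^+ 2 = r ^+ 2 - x ^+ 2 by rewrite rE; ring.
  by field.
have acos_pi := acos_lepi xr; have acos0 := acos_ge0 xr.
have [y0|y0] := leP 0 y.
  exists (acos (x / r)); first by rewrite acos0/=; lra.
  by rewrite -sinE ger0_norm.
exists (pi *+ 2 - acos (x / r)).
  (* Strictness keeps the reflected angle below 2 pi; a zero arccosine would force [y] to vanish. *)
  have : 0 < acos (x / r).
    apply: acos_gt0; case/andP: xr => -> /=.
    rewrite le_eqVlt => /predU1P[xr1|//].
    move: sinE; rewrite xr1 acos1 sin0 mulr0 => /eqP; rewrite normr_eq0.
    by rewrite (lt_eqF y0).
  by move=> ?; apply/andP; split; lra.
rewrite cosB sinB cos2pi sin2pi !mul0r !mul1r addr0 sub0r; split=> //.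
by rewrite mulrN -sinE ltr0_norm// opprK.
Qed.

(** Law of cosines. *)
Lemma planar_dist2 (r q u v : R) :
  (r * cos u - q * cos v) ^+ 2 + (r * sin u - q * sin v) ^+ 2 =
  r ^+ 2 + q ^+ 2 - 2 * (r * q) * cos (u - v).
Proof.
have -> : r ^+ 2 + q ^+ 2 = r ^+ 2 * (cos u ^+ 2 + sin u ^+ 2) +
    q ^+ 2 * (cos v ^+ 2 + sin v ^+ 2) by rewrite !cos2Dsin2 !mulr1.
by rewrite cosB; ring.
Qed.

(** Squaring d >= r + q - 1 >= 0 gives 2rq(1 - c) = d^2 - (r - q)^2 >= (2r - 1)(2q - 1); then divide
    by 2rq. *)
Lemma opposite_bound (r q d c : R) : 1 / 2 <= r -> 1 / 2 <= q -> 0 <= d ->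
  d ^+ 2 = r ^+ 2 + q ^+ 2 - 2 * (r * q) * c -> 1 <= d + (2 - r - q) ->
  2 * ((1 - (2 * r)^-1) * (1 - (2 * q)^-1)) <= 1 - c.
Proof.
move=> r2 q2 d0 dE sep.
have rq0 : 0 < 2 * (r * q) by rewrite !mulr_gt0//; lra.
rewrite -(ler_pM2l rq0).
have -> : 2 * (r * q) * (2 * ((1 - (2 * r)^-1) * (1 - (2 * q)^-1))) =
  (2 * r - 1) * (2 * q - 1) by field; apply/andP; split; lra.
have : 0 <= (d - (r + q - 1)) * (d + (r + q - 1)) by apply: mulr_ge0; lra.
lra.
Qed.

(** As before, now with d >= 1 - r + q >= 0, so that 2rq(1 - c) >= 1 - 2r + 2q. *)
Lemma same_bound (r q d c : R) : 0 < q -> q <= r <= 1 -> 0 <= d ->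
  d ^+ 2 = r ^+ 2 + q ^+ 2 - 2 * (r * q) * c -> 1 <= d + (r - q) ->
  2 * (1 - 2 * (1 - (2 * r)^-1) + (1 - (2 * r)^-1) * (1 - (2 * q)^-1)) <= 1 - c.
Proof.
move=> q0 /andP[qr r1] d0 dE sep.
have rq0 : 0 < 2 * (r * q) by rewrite !mulr_gt0//; lra.
rewrite -(ler_pM2l rq0).
have -> : 2 * (r * q) * (2 * (1 - 2 * (1 - (2 * r)^-1) +
    (1 - (2 * r)^-1) * (1 - (2 * q)^-1))) = 1 - 2 * r + 2 * q.
  by field; apply/andP; split; lra.
have : 0 <= (d - (1 - r + q)) * (d + (1 - r + q)) by apply: mulr_ge0; lra.
lra.
Qed.

Lemma petty_separated_le16 n (p : 'I_n -> petty_space R) :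
  (forall i, `|p i| = 1) -> (forall i j, i != j -> 1 <= `|p i - p j|) ->
  (n <= 16)%N.
Proof.
move=> p1 psep.
pose r i := Num.sqrt ((p i).1.1 ^+ 2 + (p i).1.2 ^+ 2).
pose s i := 0 <= (p i).2.
pose d i j := Num.sqrt
  (((p i).1.1 - (p j).1.1) ^+ 2 + ((p i).1.2 - (p j).1.2) ^+ 2).
have r0 i : 0 <= r i by exact: sqrtr_ge0.
have d0 i j : 0 <= d i j by exact: sqrtr_ge0.
have z1 i : `|(p i).2| = 1 - r i.
  by have := p1 i; rewrite petty_normE -/(r i); lra.
have r1 i : r i <= 1 by have := normr_ge0 (p i).2; rewrite z1; lra.
have sep i j : i != j -> 1 <= d i j + `|(p i).2 - (p j).2|.
  by move=> /psep; rewrite petty_normE.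
have [t t2pi pt] : exists2 t : 'I_n -> R, forall i, 0 <= t i < pi *+ 2 &
    forall i, (p i).1.1 = r i * cos (t i) /\ (p i).1.2 = r i * sin (t i).
  have /choice[t tP] i : exists t : R,
      [/\ 0 <= t < pi *+ 2, (p i).1.1 = r i * cos t & (p i).1.2 = r i * sin t].
    by have [t ? [? ?]] := polar_coordinates (p i).1.1 (p i).1.2; exists t.
  by exists t => i; have [] := tP i.
have dE i j :
    d i j ^+ 2 = r i ^+ 2 + r j ^+ 2 - 2 * (r i * r j) * cos (t i - t j).
  rewrite sqr_sqrtr ?addr_ge0 ?sqr_ge0// -planar_dist2.
  by have [-> ->] := pt i; have [-> ->] := pt j.
have same i j : i != j -> s i = s j -> r j <= r i -> 1 <= d i j + (r i - r j).
  move=> /sep + sij rij; move: (z1 i) (z1 j) sij; rewrite /s.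
  case: ger0P => [zi zi1|zi zi1] zj1 sij.
    move: zj1; rewrite ger0_norm -?sij// => zj1.
    by rewrite zi1 zj1 distrC ger0_norm; lra.
  have zj : (p j).2 < 0 by rewrite ltNge -sij.
  move: zj1; rewrite ltr0_norm// => zj1.
  by rewrite ger0_norm; lra.
have opp i j : i != j -> s i != s j -> 1 <= d i j + (2 - r i - r j).
  move=> /sep + sij; have := ler_normB (p i).2 (p j).2.
  by rewrite !z1; lra.
(* Two such points with [r j <= r i] would be at distance at most (r i + r j) + (r i - r j) = 2 r i
   < 1. *)
have capP (b : bool) : (#|[set i | (r i < 1 / 2)%R && (s i == b)]%SET| <= 1)%N.
  apply/card_le1_eqP => i j; rewrite !inE.
  move=> /andP[ri /eqP si] /andP[rj /eqP sj].
  apply/eqP; apply: contraT; rewrite eq_sym => ij.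
  wlog rij : i j ij ri rj si sj / r j <= r i.
    move=> W; have [|/ltW] := leP (r j) (r i); first exact: W.
    by apply: W => //; rewrite eq_sym.
  have := same i j ij (etrans si (esym sj)) rij.
  have : d i j <= r i + r j.
    rewrite -(@ler_pXn2r _ 2) ?nnegrE ?addr_ge0// dE.
    have := mulr_ge0 (r0 i) (r0 j); have := cos_geN1 (t i - t j).
    by move=> *; nra.
  lra.
have bandP : (#|[set i | (1 / 2 <= r i)%R]%SET| <= 14)%N.
  apply: (band_card (a := fun i => 1 - (2 * r i)^-1) (t := t) (s := s)) => //.
  - move=> i; rewrite inE => ri.
    have : (2 * r i)^-1 <= 1 by rewrite invf_le1; lra.
    have : 1 / 2 <= (2 * r i)^-1.
      by rewrite div1r lef_pV2 ?posrE; have := r1 i; lra.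
    by move=> *; apply/andP; split; lra.
  - move=> i j; rewrite !inE => ri rj ij.
    wlog rij : i j ri rj ij / r j <= r i.
      move=> W; have [|/ltW rji] := leP (r j) (r i); first exact: W.
      rewrite [X in 2 * X]mulrC -[t i - t j]opprB cosN.
      by apply: W; rewrite // eq_sym.
    apply: (opposite_bound ri rj (d0 i j) (dE i j)).
    (* On one side the height difference r i - r j is at most 2 - r i - r j, because r i <= 1. *)
    have [sij|] := eqVneq (s i) (s j); last exact: opp.
    by have := same i j ij sij rij; have := r1 i; lra.
  - move=> i j; rewrite !inE => ri rj ij sij aij.
    have rj0 : 0 < r j by lra.
    have rij : r j <= r i.
      move: aij; rewrite lerD2l lerN2 lef_pV2 ?posrE; lra.
    by apply: (same_bound _ _ (d0 i j) (dE i j)); rewrite ?rij ?r1 ?same.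
have cover : [set: 'I_n]%SET \subset [set i | (1 / 2 <= r i)%R]%SET :|:
    ([set i | (r i < 1 / 2)%R && (s i == true)]%SET :|:
     [set i | (r i < 1 / 2)%R && (s i == false)]%SET).
  apply/fintype.subsetP => i _; rewrite !inE ltNge.
  by case: (_ <= _) => //=; case: (s i).
rewrite -[n in (n <= _)%N]card_ord -cardsT -[16%N]/(14 + (1 + 1))%N.
apply: leq_trans (subset_leq_card cover) _.
apply: leq_trans (leq_card_setU _ _) (leq_add bandP _).
exact: leq_trans (leq_card_setU _ _) (leq_add (capP true) (capP false)).
Qed.

(** * Lower bound: fourteen rational points *)

Definition rational_petty_points : seq (petty_space R) :=
  [:: (0, 0, 1); (0, 0, -1);
      (1, 0, 0); (0, 1, 0); (-1, 0, 0); (0, -1, 0);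
      (119 / 241, - (120 / 241), - (72 / 241));
      (120 / 241, 119 / 241, 72 / 241);
      (- (119 / 241), 120 / 241, - (72 / 241));
      (- (120 / 241), - (119 / 241), 72 / 241);
      (101 / 250, 303 / 1000, - (99 / 200));
      (- (303 / 1000), 101 / 250, 99 / 200);
      (- (101 / 250), - (303 / 1000), - (99 / 200));
      (303 / 1000, - (101 / 250), 99 / 200)].

Lemma petty_norm_eq1 (p : petty_space R) (r : R) :
  0 <= r -> p.1.1 ^+ 2 + p.1.2 ^+ 2 = r ^+ 2 -> `|p.2| = 1 - r -> `|p| = 1.
Proof.
by move=> r0 pr zr; rewrite petty_normE pr sqrtr_sqr ger0_norm// zr; lra.
Qed.

(** Removes the square root and the absolute value: [w] will be the height difference with one sign
    or the other, leaving rational arithmetic. *)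
Lemma petty_dist_gt1 (p q : petty_space R) (w : R) :
  w <= `|p.2 - q.2| ->
  1 < w \/ (1 - w) ^+ 2 < (p.1.1 - q.1.1) ^+ 2 + (p.1.2 - q.1.2) ^+ 2 ->
  1 < `|p - q|.
Proof.
rewrite petty_normE/= => wz [w1|wpq].
  by rewrite (lt_le_trans (lt_le_trans w1 wz))// lerDr sqrtr_ge0.
have : `|1 - w| < Num.sqrt ((p.1.1 - q.1.1) ^+ 2 + (p.1.2 - q.1.2) ^+ 2).
  by rewrite -sqrtr_sqr ltr_sqrt// (le_lt_trans _ wpq)// sqr_ge0.
by have := ler_norm (1 - w); lra.
Qed.

Lemma rational_petty_points_unit i :
  (i < 14)%N -> `|nth 0 rational_petty_points i| = 1.
Proof.
do 2 (case: i => [_|i];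
  first by apply: (@petty_norm_eq1 _ 0); rewrite /= ?normrN ?normr1; lra).
do 4 (case: i => [_|i];
  first by apply: (@petty_norm_eq1 _ 1); rewrite /= ?normr0; lra).
(* The radii are rational by 119^2 + 120^2 = 169^2 and, in the last group, 303^2 + 404^2 = 505^2. *)
do 4 (case: i => [_|i];
  first by apply: (@petty_norm_eq1 _ (169 / 241));
    rewrite /= ?normrN ?ger0_norm; lra).
do 4 (case: i => [_|i];
  first by apply: (@petty_norm_eq1 _ (101 / 200));
    rewrite /= ?normrN ?ger0_norm; lra).
by [].
Qed.

Lemma rational_petty_points_far :
  pairwise (fun p q => 1 < `|p - q|) rational_petty_points.
Proof.
rewrite /=; do !(apply/andP; split);
  match goal with
  | |- is_true true => exact isT
  | |- is_true (1 < `|?p - ?q|) =>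
    first
      [ apply: (@petty_dist_gt1 p q _ (ler_norm _)) => /=;
        first [left; lra | right; lra]
      | apply: (@petty_dist_gt1 p q (- (p.2 - q.2))) => /=;
        first [by rewrite -normrN ler_norm | right; lra] ]
  end.
Qed.

End PettySpace.

(** * Return to families of balls and their maximal sizes *)

Lemma kissing_family_le16 (R : realType) n (c : 'I_n -> petty_space R) :
  kissing_family c -> (n <= 16)%N.
Proof.
move=> /kissing_familyP[c2 csep].
apply: (@petty_separated_le16 R n (fun i => 2^-1 *: c i)) => [i|i j ij].
  by rewrite normrZ c2 gtr0_norm ?invr_gt0//; lra.
by rewrite -scalerBr normrZ gtr0_norm ?invr_gt0//; have := csep i j ij; lra.
Qed.

Lemma strict_kissing_family14 (R : realType) :
  exists c : 'I_14 -> petty_space R, strict_kissing_family c.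
Proof.
exists (fun i => 2 *: nth 0 rational_petty_points i).
apply/strict_kissing_familyP; split=> [i|i j ij].
  by rewrite normrZ rational_petty_points_unit// gtr0_norm//; lra.
rewrite -scalerBr normrZ gtr0_norm//.
suff : 1 < `|nth 0 rational_petty_points i -
             nth 0 rational_petty_points j| :> R.
  by lra.
wlog ltij : i j ij / (i < j)%N.
  move=> W; have [|ji|/val_inj/eqP] := ltngtP i j; first exact: W.
    by rewrite distrC; apply: W; rewrite // eq_sym.
  by rewrite (negbTE ij).
by apply: (pairwiseP 0 rational_petty_points_far) => //; rewrite inE.
Qed.

Theorem theorem1 (R : realType) :
  exists H' H : nat,
    is_strict_hadwiger_number (petty_space R) H' /\
    is_hadwiger_number (petty_space R) H /\
    (14 <= H')%N /\ (H' <= H)%N /\ (H <= 16)%N.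
Proof.
have le16 :
    ubound [set n | exists c : 'I_n -> petty_space R, kissing_family c] 16.
  by move=> n [c /kissing_family_le16].
have le16' :
    ubound [set n | exists c : 'I_n -> petty_space R,
              strict_kissing_family c] 16.
  by move=> n [c /strict_kissing_family_kissing/kissing_family_le16].
have [H' maxH' /andP[H'14 _]] :=
  exists_maximum (strict_kissing_family14 R) le16'.
(* A strict family of maximal size is also a kissing family; as the attained size it yields
   [H' <= H]. *)
have [c cK] := maxH'.1.
have [H maxH /andP[H'H H16]] :=
  exists_maximum (ex_intro _ c (strict_kissing_family_kissing cK)) le16.
by exists H', H.
Qed.
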